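(* Let $F$ be a finite field with $|F|=q$, let $n>1$ be an odd integer with $\gcd(n,q)=1$, and let $G$ be an abelian group of order $n$. Let $\mathcal D=\{C_{1,b}\mid b\in FG,\ b\overline b=-1\}$, where $C_{1,b}=\{(u,ub)\mid u\in FG\}\le (FG)^2$. Then $$|\mathcal D|=\begin{cases}\prod_{i=1}^r(q^{n_i}+1)\prod_{j=1}^s(q^{n_{r+j}}-1), & q\text{ even};\\[4pt] 2\prod_{i=1}^r(q^{n_i}+1)\prod_{j=1}^s(q^{n_{r+j}}-1), & q\equiv1\pmod 4;\\[4pt] 0,& q\equiv-1\pmod 4.\end{cases}$$
   Context: $FG$ is the group algebra; for $a=\sum_{x\in G}a_xx\in FG$ put $\overline a=\sum_{x\in G}a_xx^{-1}$ (an algebra automorphism, the ''bar'' map). $FG$ is a semisimple commutative algebra; let $E$ be the set of its primitive idempotents, and $e_0=\frac1n\sum_{x\in G}x\in E$. The bar map permutes $E$ and fixes $e_0$. Write $$E=\{e_0\}\cup\{e_1,\dots,e_r\}\cup\{e_{r+1},\overline e_{r+1},\dots,e_{r+s},\overline e_{r+s}\}$$ (distinct elements), where $\overline e_i=e_i$ for $1\le i\le r$ and $\overline e_{r+j}\ne e_{r+j}$ for $1\le j\le s$. Put $\widehat e_{r+j}=e_{r+j}+\overline e_{r+j}$. Define $n_i=\frac12\dim_F FGe_i$ for $1\le i\le r$ and $n_{r+j}=\frac12\dim_F FG\widehat e_{r+j}$ for $1\le j\le s$ (these are integers). $\mathcal D$ is the set of all self-dual $2$-quasi-$FG$ codes of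 type I. *)

(* Defs.v *)
From HB Require Import structures.
From mathcomp Require Import all_boot all_order all_fingroup all_algebra.
From mathcomp Require Import all_field.

Set Implicit Arguments.
Unset Strict Implicit.
Unset Printing Implicit Defensive.

Import GRing.Theory.
Local Open Scope ring_scope.

(* The element sum_x a_x x of the group algebra FG is encoded by its           *)
(* coefficient function x |-> a_x. The alias hides the pointwise ring          *)
(* structure that MathComp puts on {ffun G -> F}. The ground ring is F^o       *)
(* because {ffun G -> V} inherits its F-module structure from V.               *)
Definition group_algebra (F : fieldType) (G : finGroupType) : Type :=
  {ffun G -> F^o}.

Section GroupAlgebra.

Variables (F : fieldType) (G : finGroupType).
Local Notation FG := (group_algebra F G).

HB.instance Definition _ := Vector.copy FG {ffun G -> F^o}.

Definition galg_basis (x : G) : FG := [ffun y => (y == x)%:R : F].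

Definition galg_mul (a b : FG) : FG :=
  [ffun z => \sum_(x : G) (a x : F) * (b (x^-1 * z)%g : F)].

Fact galg_mulA : associative galg_mul.
Proof.
move=> a b c; apply/ffunP=> z; rewrite !ffunE.
under eq_bigr do rewrite ffunE big_distrr /=.
under [RHS]eq_bigr do rewrite ffunE big_distrl /=.
rewrite [RHS]exchange_big; apply: eq_bigr => x _ /=.
rewrite [RHS](reindex_inj (mulgI x)) /=; apply: eq_bigr => y _.
by rewrite mulrA mulKg invMg mulgA.
Qed.

Fact galg_mul1 : left_id (galg_basis 1%g) galg_mul.
Proof.
move=> a; apply/ffunP=> z; rewrite ffunE (bigD1 1%g) //= big1 => [|x /negPf nx].
  by rewrite ffunE eqxx mul1r invg1 mul1g addr0.
by rewrite ffunE nx mul0r.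
Qed.

Fact galg_mulr1 : right_id (galg_basis 1%g) galg_mul.
Proof.
move=> a; apply/ffunP=> z; rewrite ffunE (bigD1 z) //= big1 => [|x nx].
  by rewrite ffunE mulVg eqxx mulr1 addr0.
by rewrite ffunE -eq_mulVg1 (negPf nx) mulr0.
Qed.

Fact galg_mulDl : left_distributive galg_mul +%R.
Proof.
move=> a b c; apply/ffunP=> z; rewrite !ffunE -big_split /=.
by apply: eq_bigr => x _; rewrite ffunE mulrDl.
Qed.

Fact galg_mulDr : right_distributive galg_mul +%R.
Proof.
move=> a b c; apply/ffunP=> z; rewrite !ffunE -big_split /=.
by apply: eq_bigr => x _; rewrite ffunE mulrDr.
Qed.

Fact galg_1_neq0 : galg_basis 1%g != 0 :> FG.
Proof.
apply/eqP=> /ffunP/(_ 1%g); rewrite !ffunE eqxx => /eqP.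
by rewrite oner_eq0.
Qed.

HB.instance Definition _ := GRing.Zmodule_isNzRing.Build FG
  galg_mulA galg_mul1 galg_mulr1 galg_mulDl galg_mulDr galg_1_neq0.

Fact galg_scaleAl (k : F) (a b : FG) : k *: (a * b) = k *: a * b.
Proof.
apply/ffunP=> z; rewrite !ffunE scaler_sumr; apply: eq_bigr => x _.
by rewrite ffunE scalerAl.
Qed.

HB.instance Definition _ := GRing.Lmodule_isLalgebra.Build F FG galg_scaleAl.

Fact galg_scaleAr (k : F) (a b : FG) : k *: (a * b) = a * (k *: b).
Proof.
apply/ffunP=> z; rewrite !ffunE scaler_sumr; apply: eq_bigr => x _.
by rewrite ffunE [RHS]mulrCA.
Qed.

HB.instance Definition _ := GRing.Lalgebra_isAlgebra.Build F FG galg_scaleAr.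
HB.instance Definition _ := Algebra_isFalgebra.Build F FG.

Definition galg_bar (a : FG) : FG :=
  \sum_(x : G) (a x : F) *: galg_basis (x^-1)%g.

Definition galg_hat (a : FG) : FG := a + galg_bar a.

Definition galg_e0 : FG := (#|[set: G]|%:R : F)^-1 *: \sum_(x : G) galg_basis x.

(* The ideal FG a: amulr a is the F-linear map u |-> u * a. *)
Definition galg_ideal (a : FG) : {vspace FG} := limg (amulr a).

(* Half the F-dimension of FG a. The halving is exact for the elements e_i and *)
(* e_j + bar e_j it is applied to.                                             *)
Definition galg_half_dim (a : FG) : nat := (\dim (galg_ideal a))./2.

(* Here e i is e_i (fixed by bar) and f j is e_(r+j) (not fixed by bar).       *)
Definition idempotent_list (r s : nat) (e : 'I_r -> FG) (f : 'I_s -> FG) :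
    seq FG :=
  galg_e0 :: [seq e i | i : 'I_r] ++
    [seq f j | j : 'I_s] ++ [seq galg_bar (f j) | j : 'I_s].

End GroupAlgebra.

HB.instance Definition _ (F : finFieldType) (G : finGroupType) :=
  Finite.copy (group_algebra F G) {ffun G -> F}.

Section FiniteGroupAlgebra.

Variables (F : finFieldType) (G : finGroupType).
Local Notation FG := (group_algebra F G).

Definition primitive_idempotents : {set FG} :=
  [set e | [&& e != 0, e * e == e &
    [forall f : FG, forall g : FG,
      [&& f * f == f, g * g == g, f * g == 0, g * f == 0 & e == f + g]
        ==> (f == 0) || (g == 0)]]].

Definition code_1 (b : FG) : {set FG * FG} := [set (u, u * b) | u : FG].

Definition selfdual_typeI_codes : {set {set FG * FG}} :=
  [set code_1 b | b : FG & b * galg_bar b == -1].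

End FiniteGroupAlgebra.

(* Main.v *)
From HB Require Import structures.
Require Import Defs.
From mathcomp Require Import all_boot all_order all_fingroup all_algebra.
From mathcomp Require Import all_field all_solvable.
From mathcomp Require Import ring zify.

(* A code C_{1,b} determines b, so one counts the b with b * bar b = -1. With *)
(* N = q ^ totient n one has x ^ N = x on FG, so FG is reduced, the ideals of *)
(* its primitive idempotents are fields, and these idempotents sum to 1. The *)
(* count is therefore the product of the counts of b * bar b = -h in FG h, for *)
(* h = e_0, h = e_i and h = e_j + bar e_j. On FG e_0 = F the bar map is trivial *)
(* and square roots of -1 are counted. On the field FG e_i the bar map is an *)
(* involution, nontrivial because n is odd, so the field has Q ^ 2 elements for *)
(* Q the order of its fixed field, and by Hilbert 90 every fibre of the norm *)
(* over a nonzero fixed element has Q + 1 elements. On the last kind, bar swaps *)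
(* the two factors, and the component of b in one of them can be any unit and *)
(* determines the other. *)

Set Implicit Arguments.
Unset Strict Implicit.
Unset Printing Implicit Defensive.

(** The core argument lives in a finite commutative ring [R] with an involution [s]. For an
    idempotent [h] fixed by [s], let N(h) be the number of [b] in [R h] with [b * s b = - h]; the
    theorem asks for N(1) in [FG]. Since N is multiplicative over orthogonal sums
    ([card_skew_unitsD], [card_skew_units_sum]) and 1 is the sum of the minimal idempotents
    ([sum_minimal_idempotents]), it suffices to treat each orbit of [s] on these. An orbit of size
    two contributes the number of units of one factor ([card_skew_units_swapped]). A fixed
    idempotent on whose ideal [s] is nontrivial contributes a norm fibre of a quadratic extension of
    finite fields ([card_skew_units_fixed]). The idempotent [e_0] contributes the number of square
    roots of -1 in [F] ([card_skew_units_e0]), which is 1, 2 or 0 and is the source of the three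
    cases. For [FG], coprimality of n and q makes the components fields ([galg_expr_totient],
    [minimal_field_idempotent]), and odd order makes bar nontrivial on every fixed component other
    than that of [e_0] ([galg_bar_nontrivial]). *)

Import GRing.Theory.

(** * Minimal idempotents of a finite commutative ring *)

Section IdempotentComponents.

Local Open Scope ring_scope.

Variable R : finComNzRingType.
Implicit Types e h k x y b : R.

(** For idempotent [h] this is the principal ideal [R h], a ring with unit [h]. *)
Definition idem_ideal h : {set R} := [set x | x * h == x].

Lemma idem_idealP h x : reflect (x * h = x) (x \in idem_ideal h).
Proof. by rewrite inE; apply: eqP. Qed.

Definition minimal_idempotent e : bool :=
  [&& e != 0, e * e == e &
      [forall h, (h * h == h) && (h * e == h) ==> (h == 0) || (h == e)]].

Lemma minimal_idempotentP e :
  reflect [/\ e != 0, e * e = e &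
              forall h, h * h = h -> h * e = h -> h = 0 \/ h = e]
          (minimal_idempotent e).
Proof.
apply: (iffP and3P) => [[e0 /eqP ee /forallP mine] | [e0 ee mine]].
  split=> // h hh he; have := mine h; rewrite hh he !eqxx /=.
  by case/orP=> /eqP; [left | right].
split=> //; first exact/eqP.
apply/forallP=> h; apply/implyP=> /andP[/eqP hh /eqP he].
by case: (mine h hh he) => ->; rewrite eqxx ?orbT.
Qed.

(** The product [e * h] is an idempotent below both; if nonzero, it would equal both. *)
Lemma minimal_idempotent_orthogonal e h :
  minimal_idempotent e -> minimal_idempotent h -> e != h -> e * h = 0.
Proof.
move=> /minimal_idempotentP[_ ee mine] /minimal_idempotentP[_ hh minh] neq.
have eh_idem : (e * h) * (e * h) = e * h by rewrite mulrACA ee hh.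
case: (mine _ eh_idem); rewrite // ?[_ * _ * e]mulrAC ?ee // => eh_e.
case: (minh _ eh_idem); rewrite // -?mulrA ?hh // => eh_h.
by rewrite -eh_e eh_h eqxx in neq.
Qed.

Lemma idem_ideal_card_lt h k :
  h * h = h -> k * h = k -> k <> h -> (#|idem_ideal k| < #|idem_ideal h|)%N.
Proof.
move=> hh kh neq; apply: proper_card; apply/properP; split.
  by apply/subsetP=> x /idem_idealP xk; apply/idem_idealP; rewrite -xk -mulrA kh.
exists h; first exact/idem_idealP.
by apply/idem_idealP=> hk; apply: neq; rewrite -kh mulrC.
Qed.

(** Descent on the size of the ideal: a nonzero idempotent strictly below [h] generates a strictly
    smaller ideal. *)
Lemma exists_minimal_idempotent h :
  h != 0 -> h * h = h -> exists2 e, minimal_idempotent e & e * h = e.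
Proof.
have [m] := ubnP #|idem_ideal h|; elim: m => // m IHm in h *.
rewrite ltnS => le_hm h0 hh;
  have [|/minimal_idempotentP nmin] := boolP (minimal_idempotent h).
  by exists h.
have [/existsP[k /and4P[/eqP kk /eqP kh k0 /eqP nkh]] | nok] := boolP [exists k,
    [&& k * k == k, k * h == k, k != 0 & k != h]].
  have [|e mine ek] := IHm k _ k0 kk.
    exact: leq_trans (idem_ideal_card_lt hh kh nkh) le_hm.
  by exists e; rewrite // -ek -mulrA kh.
case: nmin; split=> // k kk kh; move/existsPn/(_ k): nok.
rewrite kk kh !eqxx /=; case: eqP; first by left.
by case: eqP => //; right.
Qed.

(** The sum [t] is an idempotent absorbed by every minimal idempotent. If [1 - t] were nonzero, a
    minimal [e] below it would satisfy [e = e * (1 - t) = 0]. *)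
Lemma sum_minimal_idempotents :
  \sum_(e | minimal_idempotent e) e = 1.
Proof.
set t := (X in X = 1).
have te e : minimal_idempotent e -> t * e = e.
  move=> mine; rewrite /t big_distrl (bigD1 e) //= big1 => [|k /andP[mink neq]].
    by case/minimal_idempotentP: mine => _ -> _; rewrite addr0.
  exact: minimal_idempotent_orthogonal.
have tt : t * t = t by rewrite {2 3}/t big_distrr; apply: eq_bigr.
apply/eqP; rewrite -subr_eq0; apply/negPn/negP=> nz.
have [||e mine] := @exists_minimal_idempotent (1 - t).
- by rewrite -oppr_eq0 opprB.
- by rewrite mulrBr mulr1 mulrBl mul1r tt subrr subr0.
rewrite mulrBr mulr1 mulrC te // subrr => e0.
by case/minimal_idempotentP: mine; rewrite -e0 eqxx.
Qed.

Definition field_idempotent e : Prop :=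
  [/\ e != 0, e * e = e &
      forall x, x * e = x -> x != 0 -> exists2 y, y * e = y & x * y = e].

(* A power of [x] is an idempotent below [e], so it is [e] by minimality. *)
Lemma minimal_field_idempotent N e :
  (1 < N)%N -> (forall x, x ^+ N = x) -> minimal_idempotent e -> field_idempotent e.
Proof.
case: N => [|[|N]] // _ exprN /minimal_idempotentP[e0 ee mine]; split=> // x xe x0.
have xx : x * x ^+ N.+1 = x by rewrite -exprS.
have [||x10|x1e] := mine (x ^+ N.+1).
- by rewrite {1}exprS -mulrA mulrCA xx mulrC -exprS.
- by rewrite exprSr -mulrA xe.
- by rewrite -xx x10 mulr0 eqxx in x0.
exists (x ^+ N * e); first by rewrite -mulrA ee.
by rewrite mulrA -exprS x1e.
Qed.

(** * The equation [b * s b = - h] and its splitting along idempotents *)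

Section Involution.

Variable s : {rmorphism R -> R}.
Hypothesis sK : involutive s.

Definition skew_units h : {set R} := [set b in idem_ideal h | b * s b == - h].

Lemma skew_unitsP h b :
  reflect (b * h = b /\ b * s b = - h) (b \in skew_units h).
Proof. by rewrite !inE; apply: (iffP andP) => -[/eqP-> /eqP->]. Qed.

Lemma minimal_idempotent_involution e :
  minimal_idempotent e -> minimal_idempotent (s e).
Proof.
move=> /minimal_idempotentP[e0 ee mine]; apply/minimal_idempotentP; split.
- by apply: contra_neq e0 => se0; rewrite -(sK e) se0 rmorph0.
- by rewrite -rmorphM ee.
move=> h hh he; have [||sh|sh] := mine (s h).
- by rewrite -rmorphM hh.
- by rewrite -{1}[e]sK -rmorphM he.
- by left; rewrite -(sK h) sh rmorph0.
by right; rewrite -(sK h) sh.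
Qed.

Lemma card_skew_units0 : #|skew_units 0| = 1%N.
Proof.
rewrite -(cards1 (0 : R)); apply: eq_card => b; rewrite in_set1.
apply/skew_unitsP/eqP => [[<- _] | ->]; first by rewrite mulr0.
by rewrite !mul0r oppr0.
Qed.

Section OrthogonalSum.

Variables h k : R.
Hypotheses (hh : h * h = h) (kk : k * k = k) (hk : h * k = 0).

Let split_ideal x y : x * h = x -> y * k = y -> (x + y) * h = x /\ (x + y) * k = y.
Proof.
move=> xh yk; split.
  by rewrite mulrDl xh -{1}yk -mulrA [k * h]mulrC hk mulr0 addr0.
by rewrite mulrDl yk -{1}xh -mulrA hk mulr0 add0r.
Qed.

Let add_inj :
  {in setX (idem_ideal h) (idem_ideal k) &, injective (fun u => u.1 + u.2)}.
Proof.
move=> [x y] [x' y'] /setXP/=[/idem_idealP xh /idem_idealP yk].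
move=> /setXP/=[/idem_idealP xh' /idem_idealP yk'] /= eq_add.
have [xE yE] := split_ideal xh yk; have [xE' yE'] := split_ideal xh' yk'.
by congr (_, _); [rewrite -xE -xE' eq_add | rewrite -yE -yE' eq_add].
Qed.

Lemma card_idem_idealD :
  #|idem_ideal (h + k)| = (#|idem_ideal h| * #|idem_ideal k|)%N.
Proof.
rewrite -cardsX -(card_in_imset add_inj); apply: eq_card => b.
apply/idem_idealP/imsetP => [bhk | [[x y] /setXP/=[/idem_idealP xh /idem_idealP yk] ->]].
  exists (b * h, b * k); last by rewrite /= -mulrDr.
  by apply/setXP; split; apply/idem_idealP; rewrite -mulrA ?hh ?kk.
by rewrite mulrDr; case: (split_ideal xh yk) => -> ->.
Qed.

Hypotheses (sh : s h = h) (sk : s k = k).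

(** As [s] fixes [h] and [k], the cross terms [x * s y] and [y * s x] lie in both ideals and vanish,
    so the equation splits into one per component. *)
Lemma card_skew_unitsD :
  #|skew_units (h + k)| = (#|skew_units h| * #|skew_units k|)%N.
Proof.
have sub : {subset setX (skew_units h) (skew_units k)
             <= setX (idem_ideal h) (idem_ideal k)}.
  by move=> [x y]; rewrite !inE => /andP[/andP[-> _] /andP[-> _]].
rewrite -cardsX -(card_in_imset (sub_in2 sub add_inj)); apply: eq_card => b.
apply/skew_unitsP/imsetP => [[bhk sb] | [[x y] /setXP/=[]]].
  exists (b * h, b * k); last by rewrite /= -mulrDr.
  have hE : (h + k) * h = h by rewrite mulrDl hh [k * h]mulrC hk addr0.
  have kE : (h + k) * k = k by rewrite mulrDl kk hk add0r.
  have component g : g * g = g -> s g = g -> (h + k) * g = g -> b * g \in skew_units g.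
    move=> gg sg gE; apply/skew_unitsP; rewrite -mulrA gg; split=> //.
    by rewrite rmorphM sg mulrACA sb gg mulNr gE.
  by apply/setXP; split; apply: component.
move=> /skew_unitsP[xh sx] /skew_unitsP[yk sy] ->; split.
  by rewrite mulrDr; case: (split_ideal xh yk) => -> ->.
have xsy : x * s y = 0.
  by rewrite -xh -yk rmorphM sk mulrACA hk mulr0.
have ysx : y * s x = 0.
  by rewrite -xh -yk rmorphM sh mulrACA [k * h]mulrC hk mulr0.
by rewrite rmorphD mulrDl !mulrDr sx sy xsy ysx addr0 add0r opprD.
Qed.

End OrthogonalSum.

Lemma card_skew_units_sum (I : finType) (h : I -> R) :
    (forall i, h i * h i = h i) -> (forall i, s (h i) = h i) ->
    (forall i j, i != j -> h i * h j = 0) ->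
  #|skew_units (\sum_i h i)| = (\prod_i #|skew_units (h i)|)%N.
Proof.
move=> hh sh orth; have := index_enum_uniq I.
elim: (index_enum I) => [|i l IHl] /=; first by rewrite !big_nil card_skew_units0.
case/andP=> il uniq_l; rewrite !big_cons -(IHl uniq_l).
have sum_absorb j : j \in l -> (\sum_(k <- l) h k) * h j = h j.
  move=> jl; rewrite big_distrl (bigD1_seq j) //= hh big1 ?addr0 // => k.
  exact: orth.
apply: card_skew_unitsD => //.
- by rewrite big_distrr; apply: eq_big_seq => j; exact: sum_absorb.
- rewrite big_distrr big_seq big1 // => j jl.
  by apply: orth; apply: contraNneq il => ->.
- by rewrite rmorph_sum; apply: eq_bigr.
Qed.

(* [u + s v] with [u, v] in the ideal of [e] has norm [u v + s (u v)], so it is *)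
(* determined by the unit [u]. *)
Lemma card_skew_units_swapped e :
    field_idempotent e -> e * s e = 0 ->
  #|skew_units (e + s e)| = (#|idem_ideal e| - 1)%N.
Proof.
move=> [e0 ee inv_e] orth.
have seE : s e * s e = s e by rewrite -rmorphM ee.
have zero_in : 0 \in idem_ideal e by apply/idem_idealP; rewrite mul0r.
rewrite (cardsD1 0 (idem_ideal e)) zero_in addKn.
have inj : {in skew_units (e + s e) &, injective (fun b => b * e)}.
  move=> b b' /skew_unitsP[bE sb] /skew_unitsP[bE' sb'] eq_e.
  have key c : c * s c = - (e + s e) -> c * e * s (c * s e) = - e.
    move=> sc; rewrite rmorphM sK.
    have -> : c * e * (s c * e) = (c * s c) * (e * e) by ring.
    by rewrite sc ee mulNr mulrDl ee [s e * e]mulrC orth addr0.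
  have /(congr1 s) : s (b * s e) = s (b' * s e); last first.
    by rewrite !sK => eq_se; rewrite -bE -bE' !mulrDr eq_e eq_se.
  have absorb c : s (c * s e) = s (c * s e) * e.
    by rewrite rmorphM sK -mulrA ee.
  have swap c : s (c * s e) * (- e) = - s (c * s e) by rewrite mulrN -absorb.
  (* Uniqueness of inverses up to sign: evaluate [s (b * s e) * (b * e) * s (b' * s e)] in two
     ways. *)
  apply: oppr_inj; rewrite -swap -[in LHS](key b') // -[RHS]swap -(key b sb) eq_e.
  ring.
rewrite -(card_in_imset inj); apply: eq_card => u; apply/imsetP/setD1P.
  move=> [b /skew_unitsP[bE sb] ->]; split; last by apply/idem_idealP; rewrite -mulrA ee.
  apply/eqP=> be0; move: sb => /(congr1 ( *%R^~ e)).
  rewrite mulrAC be0 mul0r mulNr mulrDl ee [s e * e]mulrC orth addr0.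
  by move/eqP; rewrite eq_sym oppr_eq0 (negPf e0).
case=> u0 /idem_idealP ue; have [v ve uv] := inv_e u ue u0.
have sve : s v * s e = s v by rewrite -rmorphM ve.
(* Here [v] inverts [u], so [u * (- v) = - e]; this and its image under [s] are the two components
   of the norm. *)
exists (u - s v); last first.
  by rewrite mulrBl ue -sve -mulrA [s e * e]mulrC orth mulr0 subr0.
have use : u * s e = 0 by rewrite -ue -mulrA orth mulr0.
have svE : s v * e = 0 by rewrite -sve -mulrA [s e * e]mulrC orth mulr0.
have usu : u * s u = 0.
  by rewrite -{2}ue rmorphM mulrCA use mulr0.
have svv : s v * v = 0 by rewrite -{2}ve mulrCA svE mulr0.
apply/skew_unitsP; split.
  by rewrite mulrDr mulrBl ue svE mulrBl use sve subr0 sub0r.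
rewrite rmorphB sK mulrBl !mulrBr usu uv svv -rmorphM [v * u]mulrC uv.
by rewrite sub0r subr0 opprD.
Qed.

(** * Norm fibres for an involution acting nontrivially on a field *)

Section NormCount.

Variable e : R.
Hypotheses (fe : field_idempotent e) (se : s e = e).

Lemma field_idempotent_mulIf x y z :
  x * e = x -> y * e = y -> z * e = z -> z != 0 -> x * z = y * z -> x = y.
Proof.
case: fe => _ _ inv_e xe ye ze z0 eq_z; have [w _ zw] := inv_e z ze z0.
by rewrite -xe -ye -zw !mulrA eq_z.
Qed.

Lemma field_idempotent_mul_neq0 x y :
  x * e = x -> y * e = y -> x != 0 -> y != 0 -> x * y != 0.
Proof.
move=> xe ye x0 y0; apply: contra_neq x0 => xy0.
by apply: (field_idempotent_mulIf xe _ ye y0); rewrite ?mul0r.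
Qed.

Definition fixed_ideal : {set R} := [set x in idem_ideal e | s x == x].

Lemma fixed_idealP x : reflect (x * e = x /\ s x = x) (x \in fixed_ideal).
Proof. by rewrite !inE; apply: (iffP andP) => -[/eqP-> /eqP->]. Qed.

Let e0 : e != 0. Proof. by case: fe. Qed.
Let ee : e * e = e. Proof. by case: fe. Qed.
Let s_ideal x : x * e = x -> s x * e = s x.
Proof. by move=> xe; rewrite -{1}se -rmorphM xe. Qed.
Let s_neq0 x : x != 0 -> s x != 0.
Proof. by apply: contra_neq => sx0; rewrite -(sK x) sx0 rmorph0. Qed.
Let mul_ideal x y : y * e = y -> x * y * e = x * y.
Proof. by move=> ye; rewrite -mulrA ye. Qed.

Variable t : R.
Hypotheses (te : t * e = t) (st : s t != t).

(** A nonzero element negated by [s]. Dividing by it instead of by 2 keeps the argument valid in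
    characteristic 2. *)
Let d := t - s t.
Let de : d * e = d. Proof. by rewrite mulrBl te s_ideal. Qed.
Let d0 : d != 0. Proof. by rewrite subr_eq0 eq_sym. Qed.
Let sd : s d = - d. Proof. by rewrite rmorphB sK opprB. Qed.

(* [x = a + b t] with [a, b] fixed, where [b = (x - s x) / (t - s t)]. *)
Lemma card_fixed_ideal : #|idem_ideal e| = (#|fixed_ideal| ^ 2)%N.
Proof.
rewrite expnS expn1 -cardsX -(card_in_imset (f := fun u => u.1 + u.2 * t)).
  apply: eq_card => x; apply/idem_idealP/imsetP => [xe | [[a b] /setXP/=[]]].
    case: fe => _ _ /(_ d de d0)[w we dw].
    have sdw : s d * s w = e by rewrite -rmorphM dw se.
    have sw : s w = - w.
      apply: (field_idempotent_mulIf (s_ideal we) _ de d0).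
        by rewrite mulNr we.
      by rewrite mulNr mulrC [w * d]mulrC dw -sdw sd mulNr opprK.
    pose b := (x - s x) * w.
    have be : b * e = b by apply: mul_ideal.
    have sb : s b = b by rewrite rmorphM rmorphB sK sw mulrN -mulNr opprB.
    exists (x - b * t, b); last by rewrite /= subrK.
    apply/setXP; split; apply/fixed_idealP; split=> //=.
      by rewrite mulrBl xe mul_ideal.
    have : b * d = x - s x by rewrite -mulrA [w * d]mulrC dw mulrBl xe s_ideal.
    rewrite rmorphB rmorphM sb /d mulrBr => bd.
    have -> : s x = x - (b * t - b * s t) by rewrite bd; ring.
    ring.
  by move=> /fixed_idealP[ae _] /fixed_idealP[be _] ->; rewrite mulrDl ae mul_ideal.
move=> [a b] [a' b'] /setXP/=[/fixed_idealP[ae sa] /fixed_idealP[be sb]].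
move=> /setXP/=[/fixed_idealP[ae' sa'] /fixed_idealP[be' sb']] eq_t.
have eq_st := congr1 s eq_t.
rewrite !rmorphD !rmorphM sa sb sa' sb' in eq_st.
have eq_b : b = b'.
  apply: (field_idempotent_mulIf be be' de d0); rewrite /d.
  have -> : b * (t - s t) = (a + b * t) - (a + b * s t) by ring.
  by rewrite eq_t eq_st; ring.
by congr (_, _) => //; move: eq_t; rewrite eq_b => /addIr.
Qed.

Let norm_fiber c : {set R} := [set x in idem_ideal e | x * s x == c].

Let norm_fiberP c x : reflect (x * e = x /\ x * s x = c) (x \in norm_fiber c).
Proof. by rewrite !inE; apply: (iffP andP) => -[/eqP-> /eqP->]. Qed.

(** Dividing by one element of the fibre over [c] sends that fibre injectively into the fibre over
    [e]. *)
Let card_norm_fiber_le c : c != 0 -> (#|norm_fiber c| <= #|norm_fiber e|)%N.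
Proof.
move=> c0; have [->|[x /norm_fiberP[xe sx]]] := set_0Vmem (norm_fiber c).
  by rewrite cards0.
have x0 : x != 0 by apply: contra_neq c0 => x0; rewrite -sx x0 mul0r.
case: fe => _ _ /(_ x xe x0)[w we xw].
have w0 : w != 0 by apply: contra_neq e0 => w0; rewrite -xw w0 mulr0.
rewrite -(card_in_imset (f := *%R^~ w)); last first.
  move=> y y' /norm_fiberP[ye _] /norm_fiberP[ye' _].
  exact: (field_idempotent_mulIf ye ye' we w0).
apply/subset_leq_card/subsetP=> _ /imsetP[y /norm_fiberP[ye sy] ->].
apply/norm_fiberP; split; first exact: mul_ideal.
by rewrite rmorphM mulrACA sy -sx mulrACA -rmorphM xw se.
Qed.

(* Hilbert 90: an element [x] of norm [e] is [y / s y] for [y = e + x], or for *)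
(* [y = t - s t] when [x = - e]. *)
Let card_norm_fiber1_le :
  (#|norm_fiber e| * #|fixed_ideal :\ 0%R| <= #|idem_ideal e :\ 0%R|)%N.
Proof.
pose g x := if x == - e then d else e + x.
have gP x : x \in norm_fiber e -> [/\ g x * e = g x, g x != 0 & x * s (g x) = g x].
  move=> /norm_fiberP[xe sx]; rewrite /g; case: eqP => [-> | neq].
    by split=> //; rewrite sd mulrNN mulrC de.
  split; first by rewrite mulrDl ee xe.
    by rewrite addrC -[e]opprK subr_eq0; apply/eqP.
  by rewrite rmorphD se mulrDr xe sx addrC.
(* The pair [(x, c)] is recovered from [y = c * g x]: first [x = y / s y], where the fixed factor
   [c] cancels, then [c]. *)
rewrite -cardsX -(card_in_imset (f := fun u => u.2 * g u.1)).
  apply/subset_leq_card/subsetP=> _ /imsetP[[x c] /setXP/=[xN /setD1P[c0]] + ->].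
  move=> /fixed_idealP[ce _]; have [ge g0 _] := gP x xN.
  apply/setD1P; split; first exact: field_idempotent_mul_neq0.
  by apply/idem_idealP; apply: mul_ideal.
move=> [x c] [x' c'] /setXP/=[xN /setD1P[c0 /fixed_idealP[ce sc]]].
move=> /setXP/=[xN' /setD1P[c0' /fixed_idealP[ce' sc']]] eq_y.
have [ge g0 sg] := gP x xN; have [ge' g0' sg'] := gP x' xN'.
have eq_x : x = x'.
  have ye : c * g x * e = c * g x by apply: mul_ideal.
  have y0 : c * g x != 0 by apply: field_idempotent_mul_neq0.
  have [xe _] := norm_fiberP _ _ xN; have [xe' _] := norm_fiberP _ _ xN'.
  apply: (field_idempotent_mulIf xe xe' (s_ideal ye) (s_neq0 y0)).
  by rewrite [in RHS]eq_y !rmorphM sc sc' mulrCA sg mulrCA sg'.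
congr (_, _) => //; apply: (field_idempotent_mulIf ce ce' ge g0).
by rewrite eq_y eq_x.
Qed.

(** Let Q be the order of the fixed field. The Q^2 - 1 nonzero elements are spread by the norm over
    Q - 1 nonzero fixed values, and no fibre exceeds the one over [e], which has at most Q + 1
    elements. Hence every fibre has exactly Q + 1, in particular the one over [- e]; surjectivity of
    the norm comes out of the count. *)
Lemma card_skew_units_fixed : #|skew_units e| = (#|fixed_ideal| + 1)%N.
Proof.
have Ne : - e \in fixed_ideal :\ 0.
  apply/setD1P; rewrite oppr_eq0; split=> //.
  by apply/fixed_idealP; rewrite mulNr ee rmorphN se.
have sum_fibers :
    #|idem_ideal e :\ 0%R| = (\sum_(c in fixed_ideal :\ 0%R) #|norm_fiber c|)%N.
  rewrite -sum1_card (partition_big (fun x => x * s x) (mem (fixed_ideal :\ 0%R))).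
    apply: eq_bigr => c /setD1P[c0 /fixed_idealP[ce sc]]; rewrite sum1dep_card.
    apply: eq_card => x; rewrite !inE; case: (x =P 0) => [->|_] //=.
    by rewrite !mul0r eqxx [0 == c]eq_sym (negPf c0).
  move=> x /setD1P[x0 /idem_idealP xe]; apply/setD1P; split.
    by apply: field_idempotent_mul_neq0; rewrite ?s_ideal ?s_neq0.
  apply/fixed_idealP; rewrite mul_ideal ?s_ideal // rmorphM sK.
  by rewrite mulrC.
have K0 : #|idem_ideal e| = (#|idem_ideal e :\ 0%R|).+1.
  by rewrite (cardsD1 0) inE mul0r eqxx.
have F0 : #|fixed_ideal| = (#|fixed_ideal :\ 0%R|).+1.
  by rewrite (cardsD1 0) !inE mul0r rmorph0 eqxx.
have cK := card_fixed_ideal; rewrite K0 F0 in cK *.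
have F1 := cardsD1 (- e) (fixed_ideal :\ 0); rewrite Ne in F1.
have le1 := card_norm_fiber1_le.
have leN : (\sum_(c in fixed_ideal :\ 0%R | c != - e) #|norm_fiber c| <=
            #|(fixed_ideal :\ 0%R) :\ - e| * #|norm_fiber e|)%N.
  rewrite -sum_nat_const.
  rewrite [leqRHS](eq_bigl (fun c => (c \in fixed_ideal :\ 0%R) && (c != - e))).
    by apply: leq_sum => c /andP[/setD1P[c0 _] _]; apply: card_norm_fiber_le.
  by move=> c; rewrite in_setD1 andbC.
rewrite (bigD1 (- e)) //= in sum_fibers.
have leS : (#|norm_fiber (- e)| <= #|norm_fiber e|)%N.
  by apply: card_norm_fiber_le; rewrite oppr_eq0.
rewrite -[skew_units e]/(norm_fiber (- e)).
(* With [f = m + 1] one has [k = a + S <= b + m * b = f * b <= k = f * (f + 2)], so all inequalities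
   are tight and [a = b = f + 2]. *)
move: leS leN le1 cK sum_fibers F1; clear.
move: #|norm_fiber (- e)| #|norm_fiber e| #|fixed_ideal :\ 0%R| (bigop _ _ _).
move: #|_ :\ - e| #|idem_ideal e :\ 0%R| => /= m k a b f S.
nia.
Qed.

End NormCount.

End Involution.

End IdempotentComponents.

(** * The bar map and the idempotent [galg_e0] over an arbitrary field *)

Section GroupAlgebraTheory.

Local Open Scope ring_scope.

Variables (F : fieldType) (G : finGroupType).
Local Notation FG := (group_algebra F G).
Implicit Types a b : FG.

Lemma galg_mulE a b z : (a * b) z = \sum_(x : G) (a x : F) * (b (x^-1 * z)%g : F).
Proof. by rewrite ffunE. Qed.

Lemma galg_barE a z : galg_bar a z = a (z^-1)%g.
Proof.
rewrite /galg_bar sum_ffunE (bigD1 (z^-1)%g) //= big1 => [|x nx].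
  by rewrite !ffunE invgK eqxx addr0 [LHS]mulr1.
by rewrite !ffunE eq_sym (inv_eq invgK) (negPf nx) [LHS]mulr0.
Qed.

Lemma galg_sum_basis a : a = \sum_(x : G) (a x : F) *: galg_basis F x.
Proof.
apply/ffunP=> z; rewrite sum_ffunE (bigD1 z) //= big1 => [|x nx].
  by rewrite !ffunE eqxx addr0 [RHS]mulr1.
by rewrite !ffunE eq_sym (negPf nx) [LHS]mulr0.
Qed.

Lemma galg_basisM (x y : G) :
  galg_basis F x * galg_basis F y = galg_basis F (x * y)%g :> FG.
Proof.
apply/ffunP=> z; rewrite galg_mulE (bigD1 x) //= big1 => [|w nw].
  by rewrite !ffunE eqxx mul1r addr0 (can2_eq (mulKg _) (mulKVg _)) invgK.
by rewrite ffunE (negPf nw) mul0r.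
Qed.

Lemma galg_basisX (x : G) k : galg_basis F x ^+ k = galg_basis F (x ^+ k)%g :> FG.
Proof. by elim: k => // k IHk; rewrite exprS IHk galg_basisM expgS. Qed.

Lemma galg_bar_basis (x : G) : galg_bar (galg_basis F x) = galg_basis F (x^-1)%g.
Proof. by apply/ffunP=> z; rewrite galg_barE !ffunE (inv_eq invgK). Qed.

Lemma galg_barK : involutive (@galg_bar F G).
Proof. by move=> a; apply/ffunP=> z; rewrite !galg_barE invgK. Qed.

Fact galg_bar_is_linear : linear (@galg_bar F G).
Proof.
by move=> c a b; apply/ffunP=> z; rewrite !(galg_barE, ffunE).
Qed.

HB.instance Definition _ :=
  GRing.isLinear.Build F FG FG *:%R (@galg_bar F G) galg_bar_is_linear.

Lemma galg_bar_e0 : galg_bar (galg_e0 F G) = galg_e0 F G.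
Proof.
rewrite /galg_e0 linearZ linear_sum (reindex_inj invg_inj) /=; congr (_ *: _).
by apply: eq_bigr => x _; rewrite galg_bar_basis invgK.
Qed.

Lemma galg_idealP h a : h * h = h -> reflect (a * h = a) (a \in galg_ideal h).
Proof.
move=> hh; apply: (iffP memv_imgP) => [[u _ ->] | ah].
  by rewrite lfunE /= -mulrA hh.
by exists a; rewrite ?memvf // lfunE.
Qed.

Hypothesis G_abelian : abelian [set: G].

Lemma abelian_mulgC : commutative (@mulg G).
Proof. by move=> x y; apply: (centsP G_abelian); rewrite inE. Qed.

Lemma galg_mulC : commutative (@GRing.mul FG).
Proof.
move=> a b; apply/ffunP=> z; rewrite !galg_mulE.
rewrite (reindex_inj (inj_comp (mulIg z) invg_inj)) /=.
apply: eq_bigr => x _; rewrite invMg invgK mulrC; congr (_ * _).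
  by rewrite abelian_mulgC mulgA mulgV mul1g.
Qed.

Fact galg_bar_is_monoid_morphism : monoid_morphism (@galg_bar F G).
Proof.
split; first by rewrite galg_bar_basis invg1.
move=> a b; apply/ffunP=> z; rewrite galg_barE !galg_mulE.
rewrite (reindex_inj invg_inj); apply: eq_bigr => x _.
by rewrite !galg_barE invgK invMg invgK abelian_mulgC.
Qed.

(** Each group element permutes the terms of [galg_e0], so [a] acts on it through its augmentation
    and the ideal it generates is a line. *)
Lemma galg_mul_e0 a : a * galg_e0 F G = (\sum_x (a x : F)) *: galg_e0 F G.
Proof.
rewrite {1}[a]galg_sum_basis big_distrl scaler_suml /=; apply: eq_bigr => x _.
rewrite -scalerAl -scalerAr big_distrr /= (eq_bigr _ (fun y _ => galg_basisM x y)).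
by rewrite -(reindex_inj (mulgI x) (P := xpredT) (F := fun y => galg_basis F y)).
Qed.

(* If [bar] were trivial on [FG h], every [x ^+ 2] would act trivially on [h], *)
(* hence so would every [x], as [G] has odd order. *)
Lemma galg_bar_nontrivial h : odd #|[set: G]| -> #|[set: G]|%:R != 0 :> F ->
    h * h = h -> (forall a, a * h = a -> galg_bar a = a) ->
  h * galg_e0 F G = h.
Proof.
move=> oddG nG hh triv.
have [_ barM] := galg_bar_is_monoid_morphism.
have barh : galg_bar h = h by apply: triv.
have hx x : galg_basis F x * h = h.
  have inv y : galg_basis F (y ^+ 2)%g * h = h.
    have : galg_bar (galg_basis F y * h) = galg_basis F y * h.
      by apply: triv; rewrite -mulrA hh.
    rewrite barM barh galg_bar_basis => eqy.
    by rewrite expgS expg1 -galg_basisM -mulrA -eqy mulrA galg_basisM mulgV mul1r.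
  (* Since n is odd, [x] is the square of its power with exponent (n + 1) / 2. *)
  have <- : ((x ^+ (#|[set: G]|.+1)./2) ^+ 2 = x)%g.
    rewrite -expgM muln2 halfK /= oddG subn0 expgS.
    by rewrite (expg_cardG (G := [set: G])) ?mulg1 ?inE.
  exact: inv.
rewrite galg_mulC /galg_e0 -scalerAl big_distrl /= (eq_bigr _ (fun x _ => hx x)).
by rewrite sumr_const -cardsT -scaler_nat scalerA mulVf ?scale1r.
Qed.

End GroupAlgebraTheory.

(** * Cardinalities and characteristic over a finite field *)

Section FiniteGroupAlgebraTheory.

Local Open Scope ring_scope.

Variables (F : finFieldType) (G : finGroupType).
Local Notation FG := (group_algebra F G).
Local Notation q := #|F|.

Lemma card_galg_ideal (V : {vspace FG}) : #|[set a : FG | a \in V]| = (q ^ \dim V)%N.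
Proof. by rewrite cardsE; exact: (card_vspace (T := group_algebra F G) V). Qed.

Lemma card_selfdual_typeI_codes :
  #|selfdual_typeI_codes F G| = #|[set b : FG | b * galg_bar b == -1]|.
Proof.
rewrite /selfdual_typeI_codes card_imset ?cardsE // => b b' /setP/(_ (1, b)).
rewrite -{1}[b]mul1r imset_f // => /esym/imsetP[u _ [<-]].
by rewrite mul1r.
Qed.

(** Stated for any [R] of the same characteristic so that it serves both [F] and [FG]. *)
Lemma finField_pnat_pchar (R : nzSemiRingType) :
  [pchar R] =i [pchar F] -> [pchar R].-nat q.
Proof.
move=> eqR; have [p pr_p pcharFp] := finPcharP F.
rewrite (eq_pnat _ eqR) (eq_pnat _ (pcharf_eq pcharFp)) -cardsT.
exact: (abelem_pgroup (fin_ring_pchar_abelem pcharFp)).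
Qed.

Lemma card_finField_coprime k : coprime k q -> k%:R != 0 :> F.
Proof.
have [p pr_p pcharFp] := finPcharP F; rewrite -(dvdn_pcharf pcharFp) => co_kq.
apply/negP=> pk.
have pF : p.-nat q by rewrite -(eq_pnat _ (pcharf_eq pcharFp)) finField_pnat_pchar.
have [[|m] qE] := p_natP pF; have := finNzRing_gt1 F; rewrite qE // => _.
move: co_kq; rewrite qE coprime_pexpr // => /(coprime_dvdl pk).
by rewrite /coprime gcdnn => /eqP p1; rewrite p1 in pr_p.
Qed.

End FiniteGroupAlgebraTheory.

(** * The commutative ring [FG] and its Frobenius map *)

Section AbelianGroupAlgebra.

Local Open Scope ring_scope.

Variables (F : finFieldType) (G : finGroupType).
Hypothesis G_abelian : abelian [set: G].
Local Notation FG := (group_algebra F G).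
Local Notation q := #|F|.

(** Commutativity depends on the hypothesis on [G], so the structure is packed explicitly; carrier
    and operations stay those of [FG], and facts pass between the two by conversion. *)
Definition abelian_galg : finComNzRingType :=
  HB.pack FG (GRing.PzRing_hasCommutativeMul.Build FG (galg_mulC G_abelian)).

Local Notation R := abelian_galg.

Definition abelian_bar : {rmorphism R -> R} :=
  HB.pack (@galg_bar F G : R -> R)
    (GRing.isZmodMorphism.Build R R (@galg_bar F G) (raddfB (@galg_bar F G)))
    (GRing.isMonoidMorphism.Build R R (@galg_bar F G)
       (galg_bar_is_monoid_morphism F G_abelian)).

Local Notation bar := abelian_bar.

(** Raising to the power q is additive, q being a power of the characteristic, and fixes the
    coefficients; it acts only on the group elements. *)
Lemma galg_expr_card (a : FG) k :
  a ^+ (q ^ k) = \sum_x (a x : F) *: galg_basis F (x ^+ (q ^ k))%g.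
Proof.
elim: k => [|k IHk] in a *; first by rewrite expn0 expr1 [LHS]galg_sum_basis.
have pnat_q : [pchar R].-nat q by apply: finField_pnat_pchar; exact: (@pchar_lalg F FG).
have exprq_sum (I : Type) (l : seq I) (h : I -> FG) :
    (\sum_(i <- l) h i) ^+ q = \sum_(i <- l) h i ^+ q.
  elim: l => [|i l IHl]; first by rewrite !big_nil expr0n -(ltn_predK (finNzRing_gt1 F)).
  by rewrite !big_cons -IHl; exact: (@exprDn_pchar R).
rewrite expnSr exprM IHk exprq_sum; apply: eq_bigr => x _.
by rewrite exprZn expf_card galg_basisX -expgM.
Qed.

Hypothesis co_nq : coprime #|[set: G]| q.

(** By Euler, q to the totient of n is 1 modulo n, so this iterate of Frobenius fixes every group
    element. *)
Lemma galg_expr_totient (a : FG) : a ^+ (q ^ totient #|[set: G]|) = a.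
Proof.
rewrite galg_expr_card [RHS]galg_sum_basis; apply: eq_bigr => x _.
congr (_ *: galg_basis F _).
have xG : (x ^+ #|[set: G]| = 1)%g by rewrite (expg_cardG (G := [set: G])) ?inE.
rewrite -(expg_mod _ xG) Euler_exp_totient; first by rewrite expg_mod ?expg1.
by rewrite coprime_sym.
Qed.

End AbelianGroupAlgebra.

(** * Square roots of -1 in a finite field *)

Section SquareRootsOfMinusOne.

Local Open Scope ring_scope.

Variable F : finFieldType.
Local Notation q := #|F|.

Definition sqrts_N1 : {set F} := [set c | c * c == -1].

Lemma card_finField_even : ~~ odd q -> 2 \in [pchar F].
Proof.
move=> q_even; have [p pr_p pcharFp] := finPcharP F.
have qp : p.-nat q by rewrite -(eq_pnat _ (pcharf_eq pcharFp)) finField_pnat_pchar.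
suff /eqP p2 : p == 2 by rewrite -p2.
rewrite eq_sym -dvdn_prime2 //; have [m qE] := p_natP qp.
have : (2 %| p ^ m)%N by rewrite -qE dvdn2.
by rewrite Euclid_dvdX // => /andP[].
Qed.

Lemma card_sqrts_N1_even : ~~ odd q -> #|sqrts_N1| = 1%N.
Proof.
move=> /card_finField_even char2; rewrite -(cards1 (1 : F)); apply: eq_card => c.
rewrite !inE (oppr_pchar2 char2) -subr_eq0 -[c == 1]subr_eq0.
have -> : c * c - 1 = (c - 1) ^+ 2 + (c - 1) *+ 2 by ring.
by rewrite -[_ *+ 2]mulr_natr (pcharf0 char2) mulr0 addr0 expf_eq0.
Qed.

Lemma finField_N1_neq1 : odd q -> -1 != 1 :> F.
Proof.
move=> q_odd; rewrite eq_sym -subr_eq0 opprK -mulr2n.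
by apply: card_finField_coprime; rewrite coprime2n.
Qed.

Lemma finField_expf_pred (x : F) : x != 0 -> x ^+ q.-1 = 1.
Proof.
move=> x0; apply: (mulfI x0); rewrite mulr1 -exprS prednK ?expf_card //.
exact: ltnW (finNzRing_gt1 F).
Qed.

(* The polynomial [X ^ ((q-1)/2) - 1] has a non-root [x != 0], for which *)
(* [x ^ ((q-1)/2) = -1] and [x ^ ((q-1)/4)] is a square root of [-1]. *)
Lemma card_sqrts_N1_1mod4 : q = 1 %[mod 4] -> #|sqrts_N1| = 2%N.
Proof.
move=> q1; have q_gt1 := finNzRing_gt1 F.
(* Thus (q - 1) / 2 is [2 * m.+1] and (q - 1) / 4 is [m.+1]; the successor, available as q > 1,
   keeps the degree of [P] positive. *)
have [m qE] : exists m, q = (4 * m.+1).+1.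
  move: q1 q_gt1; move: #|F| => k k1 k_gt1.
  by exists (k %/ 4).-1; have := divn_eq k 4; rewrite k1 /=; lia.
have [x x0 xN1] : exists2 x : F, x != 0 & x ^+ (2 * m.+1) != 1.
  apply/exists_inP; apply: contraT; rewrite negb_exists_in => /forall_inP all1.
  pose P : {poly F} := 'X^(2 * m.+1) - 1.
  have szP : size P = (2 * m.+1).+1 by rewrite size_XnsubC.
  have := @max_poly_roots _ P (enum [set~ (0 : F)]).
  rewrite -size_poly_eq0 szP enum_uniq -cardE cardsC1 qE => /(_ isT) H.
  suff : (4 * m.+1 < (2 * m.+1).+1)%N by lia.
  apply: H => //; apply/allP=> y; rewrite mem_enum !inE => y0.
  by rewrite rootE !hornerE subr_eq0; have := all1 y y0; rewrite negbK.
have [c cc] : exists c : F, c * c = -1.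
  exists (x ^+ m.+1); rewrite -expr2 -exprM mulnC.
  apply/eqP; rewrite -[_ == _]orFb -(negPf xN1) -eqf_sqr expr1n -exprM.
  by rewrite -(finField_expf_pred x0) qE /= mulnAC.
have c0 : c != 0.
  by apply: contra_eq_neq cc => ->; rewrite mul0r eq_sym oppr_eq0 oner_neq0.
have neq : c != - c.
  rewrite -subr_eq0 opprK -mulr2n -mulr_natr mulf_neq0 //.
  by apply: card_finField_coprime; rewrite coprime2n qE oddS oddM.
rewrite -[RHS](_ : #|[set c; - c]| = 2%N); last by rewrite cards2 neq.
by apply: eq_card => y; rewrite !inE -cc -!expr2 eqf_sqr.
Qed.

(** If [c * c = -1], then c^(q-1) is -1 to the odd power (q - 1) / 2, hence -1, against c^(q-1) =
    1. *)
Lemma card_sqrts_N1_3mod4 : q = 3 %[mod 4] -> #|sqrts_N1| = 0%N.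
Proof.
move=> q3; have q_gt1 := finNzRing_gt1 F.
have [m qE] : exists m, q = (4 * m + 3)%N.
  move: q3; move: #|F| => k k3.
  by exists (k %/ 4)%N; have := divn_eq k 4; rewrite k3 /=; lia.
apply/eqP; rewrite cards_eq0 -subset0; apply/subsetP=> c; rewrite !inE => /eqP cc.
have c0 : c != 0.
  by apply: contra_eq_neq cc => ->; rewrite mul0r eq_sym oppr_eq0 oner_neq0.
have /negP[] : -1 != 1 :> F by apply: finField_N1_neq1; rewrite qE oddD oddM.
rewrite -[X in _ == X](finField_expf_pred c0) qE.
have -> : (4 * m + 3).-1 = (2 * (2 * m).+1)%N by lia.
by rewrite exprM expr2 cc exprS exprM sqrrN !expr1n mulr1.
Qed.

End SquareRootsOfMinusOne.

(** * The count on each kind of component of [FG] *)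

Section GroupAlgebraComponents.

Local Open Scope ring_scope.

Variables (F : finFieldType) (G : finGroupType).
Hypothesis G_abelian : abelian [set: G].
Local Notation FG := (group_algebra F G).
Local Notation q := #|F|.
Local Notation R := (abelian_galg F G_abelian).
Local Notation bar := (abelian_bar F G_abelian).

Lemma abelian_barK : involutive bar.
Proof. exact: galg_barK. Qed.

(** An idempotent [h] below [a] gives the orthogonal splitting [a = h + (a - h)], and conversely
    each summand of an orthogonal splitting lies below [a]. *)
Lemma primitive_idempotentsE (a : R) :
  ((a : FG) \in primitive_idempotents F G) = minimal_idempotent a.
Proof.
rewrite inE; apply/and3P/minimal_idempotentP => [[a0 /eqP aa prim] | [a0 aa mina]].
  split=> // h hh ha.
  have ah : a * h = h :> R by rewrite mulrC.
  have /implyP := forallP (forallP prim h) (a - h : R); case/(_ _)/orP.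
  - apply/and5P; split; apply/eqP.
    + exact: hh.
    + change ((a - h : R) * (a - h) = a - h); rewrite mulrBl !mulrBr hh.
      by rewrite aa ah ha subrr subr0.
    + by change ((h : R) * (a - h) = 0); rewrite mulrBr hh ha subrr.
    + by change ((a - h : R) * h = 0); rewrite mulrBl hh ah subrr.
    + by change ((a : R) = h + (a - h)); rewrite addrC subrK.
  - by move/eqP; left.
  - by rewrite subr_eq0 => /eqP; right.
split=> //; first exact/eqP.
apply/forallP=> h; apply/forallP=> k; apply/implyP.
case/and5P=> /eqP hh /eqP kk /eqP hk /eqP kh /eqP aE.
case: (mina h hh) => [|->|ha].
- by rewrite aE; change ((h : FG) * (h + k) = h); rewrite mulrDr hh hk addr0.
- by rewrite eqxx.
apply/orP; right; apply/eqP/(@addrI FG h).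
by rewrite -aE addr0; symmetry.
Qed.

Lemma card_idem_ideal_galg (h : R) :
  h * h = h -> #|idem_ideal h| = (q ^ \dim (galg_ideal (h : FG)))%N.
Proof.
move=> hh; rewrite -card_galg_ideal; apply: eq_card => a; rewrite [RHS]inE.
by apply/idem_idealP/galg_idealP.
Qed.

(** The map [c *: e0] identifies [F] with this component; bar is trivial there, so the norm is
    squaring. *)
Lemma card_skew_units_e0 :
    minimal_idempotent (galg_e0 F G : R) ->
  #|skew_units bar (galg_e0 F G : R)| = #|sqrts_N1 F|.
Proof.
case/minimal_idempotentP=> e0_neq0 e0e0 _.
set e0 : FG := galg_e0 F G in e0_neq0 e0e0 *.
have inj : injective (fun c : F => c *: e0).
  move=> c c' /eqP; rewrite -subr_eq0 -scalerBl scaler_eq0 (negPf e0_neq0) orbF.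
  by rewrite subr_eq0 => /eqP.
have normE (c : F) : (c *: e0) * galg_bar (c *: e0) = (c * c) *: e0.
  have bar0 : galg_bar e0 = e0 by exact: galg_bar_e0.
  have -> : galg_bar (c *: e0) = c *: e0 by rewrite linearZ /= bar0.
  rewrite -scalerAl -scalerAr scalerA.
  by congr (_ *: _); exact: e0e0.
rewrite -(card_imset _ inj); apply: eq_card => b.
apply/skew_unitsP/imsetP => [[be sb] | [c]].
  have bE : b = (\sum_x (b x : F)) *: e0 by rewrite -galg_mul_e0; symmetry.
  exists (\sum_x (b x : F)) => //; rewrite inE; apply/eqP/inj.
  by rewrite -normE -bE scaleN1r; exact: sb.
rewrite inE => /eqP cc ->; split.
  change ((c *: e0) * e0 = c *: e0); rewrite -scalerAl; congr (_ *: _).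
  exact: e0e0.
by rewrite -[RHS]scaleN1r -cc; exact: normE.
Qed.

Hypothesis co_nq : coprime #|[set: G]| q.

Lemma minimal_field_idempotent_galg (h : R) :
  minimal_idempotent h -> field_idempotent h.
Proof.
apply: (@minimal_field_idempotent _ (q ^ totient #|[set: G]|)).
  rewrite -(exp1n (totient #|[set: G]|)) ltn_exp2r ?finNzRing_gt1 //.
  by rewrite totient_gt0 cardG_gt0.
by move=> a; exact: (galg_expr_totient G_abelian co_nq).
Qed.

Lemma card_skew_units_bar_fixed (h : R) :
    odd #|[set: G]| -> minimal_idempotent (galg_e0 F G : R) ->
    minimal_idempotent h -> h != galg_e0 F G -> bar h = h ->
  #|skew_units bar h| = (q ^ galg_half_dim (h : FG) + 1)%N.
Proof.
move=> oddG min0 minh neq0 barh.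
have [h0 hh _] := minimal_idempotentP _ minh.
(* Were bar trivial on the component, [h * e0] would be [h], whereas distinct minimal idempotents
   are orthogonal. *)
have [t th st] : exists2 t : R, t * h = t & bar t != t.
  have [/existsP[t /andP[/eqP th st]] | /existsPn triv] :=
    boolP [exists t : R, (t * h == t) && (bar t != t)]; first by exists t.
  case/eqP: h0; rewrite -[LHS](galg_bar_nontrivial G_abelian oddG _ hh).
  - exact: minimal_idempotent_orthogonal minh min0 neq0.
  - exact: card_finField_coprime.
  move=> a ah; have := triv a; rewrite negb_and negbK => /orP[/eqP[]//|/eqP].
  exact.
have fh := minimal_field_idempotent_galg minh.
(* The fixed field is an [F]-subspace, so its order is a power of q; as its square is the order of
   the component, the exponent is exactly half the dimension. *)
pose V := (galg_ideal (h : FG) :&: fixedSpace (linfun (@galg_bar F G)))%VS.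
have fixE : #|fixed_ideal bar h| = (q ^ \dim V)%N.
  rewrite -card_galg_ideal; apply: eq_card => a; rewrite [RHS]inE memv_cap.
  apply/fixed_idealP/andP=> [[ah ba] | [/galg_idealP-/(_ hh) ah /fixedSpaceP]].
    by split; [exact/galg_idealP | apply/fixedSpaceP; rewrite lfunE].
  by rewrite lfunE.
rewrite (card_skew_units_fixed abelian_barK fh barh th st) fixE; congr (_ ^ _ + _)%N.
have := card_fixed_ideal abelian_barK fh barh th st.
rewrite fixE card_idem_ideal_galg // -expnM => /eqP.
by rewrite eqn_exp2l ?finNzRing_gt1 // /galg_half_dim => /eqP->; rewrite muln2 doubleK.
Qed.

(** Bar matches the ideals of [h] and [bar h], so half the dimension for [galg_hat h] is exactly the
    dimension for [h]. *)
Lemma card_skew_units_bar_swapped (h : R) :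
    minimal_idempotent h -> bar h != h ->
  #|skew_units bar (h + bar h)| = (q ^ galg_half_dim (galg_hat (h : FG)) - 1)%N.
Proof.
move=> minh neq; have minbh := minimal_idempotent_involution abelian_barK minh.
have orth : h * bar h = 0.
  by apply: minimal_idempotent_orthogonal; rewrite // eq_sym.
have [_ hh _] := minimal_idempotentP _ minh.
have [_ bhbh _] := minimal_idempotentP _ minbh.
rewrite (card_skew_units_swapped abelian_barK (minimal_field_idempotent_galg minh) orth).
have card_bar : #|idem_ideal (bar h)| = #|idem_ideal h|.
  rewrite -(card_imset _ (inv_inj abelian_barK)); apply: eq_card => x.
  apply/imsetP/idem_idealP => [[y /idem_idealP yh ->]|xh].
    by rewrite -{1}[h]abelian_barK -rmorphM yh.
  exists (bar x); last by rewrite abelian_barK.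
  by apply/idem_idealP; rewrite -rmorphM xh.
have := card_idem_idealD hh bhbh orth; rewrite card_bar.
rewrite card_idem_ideal_galg; last first.
  by rewrite mulrDr !mulrDl hh bhbh orth [bar h * h]mulrC orth addr0 add0r.
rewrite card_idem_ideal_galg // -expnD => /eqP.
rewrite eqn_exp2l ?finNzRing_gt1 // => /eqP dimE.
congr (_ ^ _ - _)%N; rewrite /galg_half_dim [X in X./2]dimE.
by rewrite addnn doubleK.
Qed.

End GroupAlgebraComponents.

(** * Assembling the components *)

Section ProductFormula.

Local Open Scope ring_scope.

Variables (F : finFieldType) (G : finGroupType).
Hypothesis G_abelian : abelian [set: G].
Local Notation FG := (group_algebra F G).
Local Notation q := #|F|.
Local Notation R := (abelian_galg F G_abelian).
Local Notation bar := (abelian_bar F G_abelian).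

Hypotheses (oddG : odd #|[set: G]|) (co_nq : coprime #|[set: G]| q).
Variables (r s : nat) (e : 'I_r -> FG) (f : 'I_s -> FG).
Hypothesis idem_uniq : uniq (idempotent_list e f).
Hypothesis idem_all : primitive_idempotents F G = [set a in idempotent_list e f].
Hypothesis bar_e : forall i, galg_bar (e i) = e i.
Hypothesis bar_f : forall j, galg_bar (f j) <> f j.

Lemma card_skew_units1 :
  #|skew_units bar 1| =
    (#|sqrts_N1 F| * (\prod_(i < r) (q ^ galg_half_dim (e i) + 1) *
       \prod_(j < s) (q ^ galg_half_dim (galg_hat (f j)) - 1)))%N.
Proof.
(* The same idempotents, retyped in the commutative ring [R]. *)
pose e0 : R := galg_e0 F G; pose e' : 'I_r -> R := e; pose f' : 'I_s -> R := f.
have minE (a : R) : minimal_idempotent a = (a \in (idempotent_list e f : seq R)).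
  by rewrite -primitive_idempotentsE idem_all inE.
have min0 : minimal_idempotent e0 by rewrite minE mem_head.
have mine i : minimal_idempotent (e' i).
  rewrite minE in_cons mem_cat; apply/orP; right; apply/orP; left.
  exact: (map_f e (mem_enum _ i)).
have minf j : minimal_idempotent (f' j).
  rewrite minE in_cons !mem_cat; apply/orP; right; apply/orP; right.
  by apply/orP; left; exact: (map_f f (mem_enum _ j)).
have minbf j : minimal_idempotent (bar (f' j)).
  by have := minimal_idempotent_involution (@abelian_barK F G G_abelian) (minf j).
have idem (h : R) : minimal_idempotent h -> h * h = h.
  by case/minimal_idempotentP.
have orth := @minimal_idempotent_orthogonal R.
pose h j := f' j + bar (f' j).
have sum1 : e0 + (\sum_i e' i + \sum_j h j) = 1.
  rewrite -(sum_minimal_idempotents R) (eq_bigl _ _ minE).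
  rewrite -(big_uniq _ idem_uniq) /= /idempotent_list big_cons !big_cat /=.
  by rewrite !big_image /= big_split.
(* Absence of repetitions in the list is unpacked into pairwise distinctness, which for minimal
   idempotents means orthogonality. *)
move: idem_uniq; rewrite /idempotent_list cons_uniq !cat_uniq !mem_cat !negb_or.
case/andP=> /and3P[e0e e0f e0bf] /and3P[/injectiveP inj_e].
rewrite has_cat negb_or => /andP[disj_f disj_bf] /and3P[/injectiveP inj_f disj_fbf _].
have neq_e0 i : e' i != e0.
  by apply: contraNneq e0e => eq0; rewrite -[galg_e0 F G]eq0;
    exact: (map_f e (mem_enum _ i)).
have neq_f0 j : f' j != e0.
  by apply: contraNneq e0f => eq0; rewrite -[galg_e0 F G]eq0;
    exact: (map_f f (mem_enum _ j)).
have neq_bf0 j : bar (f' j) != e0.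
  apply: contraNneq e0bf => eq0; rewrite -[galg_e0 F G]eq0.
  exact: (map_f (fun j => galg_bar (f j)) (mem_enum _ j)).
have neq_ef i j : e' i != f' j.
  apply: contraNneq disj_f => ef; apply/hasP; exists (f j).
    exact: (map_f f (mem_enum _ j)).
  by rewrite -[f j]ef; exact: (map_f e (mem_enum _ i)).
have neq_ebf i j : e' i != bar (f' j).
  apply: contraNneq disj_bf => ef; apply/hasP; exists (galg_bar (f j)).
    exact: (map_f (fun j => galg_bar (f j)) (mem_enum _ j)).
  by rewrite -[galg_bar (f j)]ef; exact: (map_f e (mem_enum _ i)).
have neq_fbf j k : f' j != bar (f' k).
  apply: contraNneq disj_fbf => ef; apply/hasP; exists (galg_bar (f k)).
    exact: (map_f (fun j => galg_bar (f j)) (mem_enum _ k)).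
  by rewrite -[galg_bar (f k)]ef; exact: (map_f f (mem_enum _ j)).
have neq_f j k : j != k -> f' j != f' k by apply: contra_neq; apply: inj_f.
have neq_e j k : j != k -> e' j != e' k by apply: contra_neq; apply: inj_e.
have neq_bf j k : j != k -> bar (f' j) != bar (f' k).
  by move=> jk; rewrite (inj_eq (inv_inj (@abelian_barK F G G_abelian))) neq_f.
have hh j : h j * h j = h j.
  by rewrite /h mulrDl !mulrDr !idem // [bar _ * _]mulrC orth // addr0 add0r.
have horth j k : j != k -> h j * h k = 0.
  move=> jk; rewrite /h mulrDl !mulrDr !orth ?neq_f ?neq_bf ?addr0 //.
  by rewrite eq_sym.
have barh j : bar (h j) = h j by rewrite rmorphD abelian_barK addrC.
have eorth j k : j != k -> e' j * e' k = 0 by move=> jk; apply: orth; rewrite ?neq_e.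
have idem_sum (I : finType) (u : I -> R) : (forall i, u i * u i = u i) ->
    (forall i j, i != j -> u i * u j = 0) ->
  (\sum_i u i) * (\sum_i u i) = \sum_i u i.
  move=> uu uorth; rewrite big_distrl; apply: eq_bigr => i _ /=.
  rewrite big_distrr (bigD1 i) //= uu big1 ?addr0 // => j; rewrite eq_sym.
  exact: uorth.
have bar_sum (I : finType) (u : I -> R) :
    (forall i, bar (u i) = u i) -> bar (\sum_i u i) = \sum_i u i.
  by move=> baru; rewrite rmorph_sum; apply: eq_bigr => i _; exact: baru.
have ee i : e' i * e' i = e' i by apply: idem.
have e0e0 : e0 * e0 = e0 by apply: idem.
have bare i : bar (e' i) = e' i by apply: bar_e.
have bar0 : bar e0 = e0 by apply: galg_bar_e0.
have sum_eh : (\sum_i e' i) * (\sum_j h j) = 0.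
  rewrite big_distrl big1 // => i _; rewrite big_distrr big1 // => j _ /=.
  by rewrite /h mulrDr !orth ?addr0.
rewrite -sum1 -/e0 (card_skew_unitsD (s := bar)) //; last first.
- by rewrite rmorphD (bar_sum _ _ bare) (bar_sum _ _ barh).
- rewrite mulrDr !big_distrr /= !big1 ?addr0 // => [j|i] _.
    by rewrite /h mulrDr !orth ?addr0 //; rewrite eq_sym.
  by rewrite orth //; rewrite eq_sym.
- rewrite mulrDl !mulrDr !idem_sum // [X in _ + (X + _)]mulrC sum_eh.
  by rewrite addr0 add0r.
rewrite (card_skew_unitsD (idem_sum _ _ ee eorth) (idem_sum _ _ hh horth) sum_eh
           (bar_sum _ _ bare) (bar_sum _ _ barh)).
rewrite (card_skew_units_sum ee bare eorth) (card_skew_units_sum hh barh horth).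
rewrite card_skew_units_e0 //; congr (_ * (_ * _))%N.
  apply: eq_bigr => i _; exact: card_skew_units_bar_fixed.
apply: eq_bigr => j _; rewrite card_skew_units_bar_swapped //.
by apply/eqP; exact: bar_f.
Qed.

End ProductFormula.

Theorem theorem4p1 (F : finFieldType) (q : nat) (F_card : #|F| = q)
    (G : finGroupType) (n : nat) (G_abelian : abelian [set: G])
    (G_card : #|[set: G]| = n) (n_gt1 : 1 < n) (n_odd : odd n)
    (n_q_coprime : coprime n q)
    (r s : nat)
    (e : 'I_r -> group_algebra F G) (f : 'I_s -> group_algebra F G)
    (idem_uniq : uniq (idempotent_list e f))
    (idem_all : primitive_idempotents F G = [set a in idempotent_list e f])
    (bar_e : forall i : 'I_r, galg_bar (e i) = e i)
    (bar_f : forall j : 'I_s, galg_bar (f j) <> f j) :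
  [/\ ~~ odd q ->
        #|selfdual_typeI_codes F G| =
          (\prod_(i < r) (q ^ galg_half_dim (e i) + 1) *
           \prod_(j < s) (q ^ galg_half_dim (galg_hat (f j)) - 1))%N,
      q = 1 %[mod 4] ->
        #|selfdual_typeI_codes F G| =
          (2 * \prod_(i < r) (q ^ galg_half_dim (e i) + 1) *
           \prod_(j < s) (q ^ galg_half_dim (galg_hat (f j)) - 1))%N
    & q = 3 %[mod 4] -> #|selfdual_typeI_codes F G| = 0%N].
Proof.
subst q n; rewrite card_selfdual_typeI_codes.
(* In the ideal of 1 the membership condition [b * 1 = b] always holds. *)
have -> : #|[set b : group_algebra F G | b * galg_bar b == -1]%R| =
          #|skew_units (abelian_bar F G_abelian) 1%R|.
  apply: eq_card => b; rewrite inE; apply/eqP/skew_unitsP=> [bb | [_ bb]].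
    by split; [exact: mulr1 | exact: bb].
  exact: bb.
rewrite (card_skew_units1 G_abelian n_odd n_q_coprime idem_uniq idem_all bar_e bar_f).
split=> [q_even | q1 | q3].
- by rewrite card_sqrts_N1_even // mul1n.
- by rewrite card_sqrts_N1_1mod4 // mulnA.
- by rewrite card_sqrts_N1_3mod4.
Qed.
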